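(* For every positive integer $n$, there is a bijection $\phi$ from the set of set partitions of $[n]=\{1,2,\ldots,n\}$ to itself such that, for every partition $\pi$ of $[n]$, the number of singletons of $\phi(\pi)$ equals the number of adjacencies of $\pi$, and the number of adjacencies of $\phi(\pi)$ equals the number of singletons of $\pi$.
   Context: A partition of $[n]$ is a set of nonempty, pairwise disjoint blocks whose union is $[n]$. A singleton is a block with exactly one element. An adjacency is a pair of cyclically consecutive elements of $[n]$, i.e. $(i,i+1)$ for $1\le i\le n-1$ or $(n,1)$, whose two elements lie in the same block. (For $n=1$, the element $1$ is considered to form an adjacency with itself.) *)

(* Defs.v *)
From mathcomp Require Import all_boot.

Set Implicit Arguments.
Unset Strict Implicit.
Unset Printing Implicit Defensive.

(* The ground set [n] = {1, ..., n} is represented by 'I_n, with i : 'I_n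
   standing for i + 1. *)
Definition set_partition (n : nat) : Type :=
  {P : {set {set 'I_n}} | partition P [set: 'I_n]}.

Definition singletons (n : nat) (P : set_partition n) : {set {set 'I_n}} :=
  [set B in val P | #|B| == 1].

(* [ordS] is the cyclic successor on 'I_n. Adjacencies are ordered pairs: for
   n = 2 the block {1, 2} carries the two adjacencies (1, 2) and (2, 1); for
   n = 1 the only one is (1, 1). *)
Definition adjacencies (n : nat) (P : set_partition n) : {set 'I_n * 'I_n} :=
  [set p : 'I_n * 'I_n | (p.2 == ordS p.1) &&
     [exists B in val P, (p.1 \in B) && (p.2 \in B)]].

(* Main.v *)
(* Mark a set S of points that must be singletons and a set A of arcs (i, i+1)
   of the cycle that must be adjacencies. If no point of S is an endpoint of an
   arc of A, collapsing the arcs and deleting S leaves an arbitrary partition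
   of an (n - |S| - |A|)-element set; otherwise, for n > 1, no partition
   satisfies the constraints. Both the compatibility condition and the count
   are invariant under the half-step rotation of the cycle that exchanges
   points and arcs. By inclusion-exclusion, the number of partitions with
   singletons exactly S and adjacencies exactly A has the same invariance, and
   the bijection matches the corresponding fibers. *)
Require Import Defs.
From mathcomp Require Import all_boot.

Set Implicit Arguments.
Unset Strict Implicit.
Unset Printing Implicit Defensive.

(** * Partitions as kernels of maps *)

Lemma eq_equivalence_partition (T : finType) (R1 R2 : rel T) (D : {set T}) :
  {in D &, R1 =2 R2} -> equivalence_partition R1 D = equivalence_partition R2 D.
Proof.
move=> eqR; apply: eq_in_imset => x xD; apply/setP=> y; rewrite !inE.
by case: (boolP (y \in D)) => //= yD; apply: eqR.
Qed.

(** Every partition is the kernel of its own block map, so equality of partitions reduces to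
    comparing when points share a block. *)
Lemma preim_partition_pblock (T : finType) (P : {set {set T}}) (D : {set T}) :
  partition P D -> preim_partition (pblock P) D = P.
Proof.
move=> partP; rewrite -[RHS](equivalence_partition_pblock partP).
have /and3P[/eqP covP trivP _] := partP.
by apply: eq_equivalence_partition => x y xD yD; rewrite eq_pblock ?covP.
Qed.

Lemma eq_pblock_preim (T : finType) (rT : eqType) (f : T -> rT) (D : {set T}) :
  {in D &, forall x y, (pblock (preim_partition f D) x
                          == pblock (preim_partition f D) y) = (f x == f y)}.
Proof.
move=> x y xD yD.
have /and3P[/eqP cov triv _] := preim_partitionP f D.
rewrite eq_pblock ?cov // pblock_equivalence_partition // => a b c _ _ _.
by split=> // /eqP ->.
Qed.

(** * Counting partitions with prescribed singletons and adjacencies *)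

(** An arc is named by its tail [x]. The successor [s] is abstract so that the cycle can be
    reversed. Further singletons and adjacencies are allowed. *)
Definition constrained_partitions (T : finType) (s : T -> T) (S A : {set T}) :
    {set {set {set T}}} :=
  [set P : {set {set T}} | [&& partition P setT,
     [forall x in S, pblock P x == [set x]] &
     [forall x in A, pblock P (s x) == pblock P x]]].

(* [r] pushes every element to the end of its run of arcs in [A]; when [A] is
   the whole cycle there is no such end, and any constant [r] does. *)
Lemma run_end (T : finType) (s : T -> T) (A : {set T}) (x0 : T) :
    (forall x y, fconnect s x y) ->
  exists r : T -> T,
    [/\ forall x, A != setT -> r x \notin A,
        forall x, x \notin A -> r x = x,
        forall x, x \in A -> r (s x) = r x,
        A = setT -> forall x, r x = x0 &
        forall (Q : pred T) x, Q x ->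
          (forall y, y \in A -> Q y -> Q (s y)) -> Q (r x)].
Proof.
move=> sT; have [->|AT] := eqVneq A setT.
  exists (fun=> x0); split=> // [x|Q x Qx Qs]; first by rewrite inE.
  by rewrite -(iter_findex (sT x x0)); elim: (findex _ _ _) => //= k /Qs ->.
pose g x := if x \in A then s x else x.
have gfix m x : iter m g x \notin A -> g (iter m g x) = iter m g x.
  by rewrite /g => /negPf ->.
have rA x : iter #|T| g x \notin A.
  (* Had the walk not left [A], it would follow [s] for [#|T|] steps and visit every point, forcing
     [A] to be [setT]. *)
  apply/negP=> rxA; case/negP: AT; rewrite -subTset; apply/subsetP=> z _.
  have iterA k : k <= #|T| -> iter k g x \in A.
    move=> kT; apply: contraLR rxA => kA.
    suff -> : iter #|T| g x = iter k g x by [].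
    rewrite -(subnK kT) iterD; elim: (_ - _) => //= j ->; exact: gfix.
  have iterE k : k <= #|T| -> iter k g x = iter k s x.
    by elim: k => //= k IH kT; rewrite -IH 1?ltnW // /g iterA // ltnW.
  have kT : findex s x z <= #|T|.
    by apply: ltnW; apply: leq_trans (findex_max (sT x z)) (max_card _).
  by rewrite -(iter_findex (sT x z)) -iterE // iterA.
exists (iter #|T| g); split=> // [x xA|x xA|AE|Q x Qx Qs].
- by elim: #|T| => //= k ->; rewrite /g (negPf xA).
- by rewrite -[s x]/(if true then s x else x) -xA -/(g x) -iterSr /= gfix.
- by rewrite AE eqxx in AT.
by elim: #|T| => //= k; rewrite /g; case: ifP => // /Qs.
Qed.

(* Both directions are kernels: restrict a partition to the run ends outside
   [S], or spread a partition of those along the runs. *)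
Lemma card_constrained_partitions (T : finType) (s : T -> T) (S A : {set T}) :
    (forall x y, fconnect s x y) ->
    (forall x, x \in A -> (x \notin S) && (s x \notin S)) ->
  #|constrained_partitions s S A| =
  #|[set P : {set {set T}} | partition P (~: (S :|: A))]|.
Proof.
move=> sT compat.
have [T0|/card_gt0P[x0 _]] := posnP #|T|.
  have empty (x : T) : False by have := max_card (pred1 x); rewrite card1 T0.
  have -> : S :|: A = setT by apply/setP=> x; case: (empty x).
  rewrite setCT; apply: eq_card => P; rewrite !inE.
  have -> : [set: T] = set0 by apply/setP=> x; case: (empty x).
  apply: andb_idr => _; apply/andP.
  by split; apply/forallP=> x; case: (empty x).
have [r [rA rid rs rT rind]] := run_end A x0 sT.
set R := ~: (S :|: A).
have RE x : (x \in R) = (x \notin S) && (x \notin A) by rewrite !inE negb_or.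
have rS x : x \notin S -> r x \notin S.
  by move=> xS; apply: (rind (fun y => y \notin S)) => // y /compat/andP[].
have rR x : A != setT -> x \notin S -> r x \in R.
  by move=> AT xS; rewrite RE rS // rA.
pose trace P := preim_partition (pblock P) R.
(* Blocks of [Q] lie in [R], so the value [[set x]] at a point of [S] collides with no other. When
   [A] is [setT], [R] is empty and [pblock] defaults to [set0], which yields a single block. *)
pose h (Q : {set {set T}}) x := if x \in S then [set x] else pblock Q (r x).
pose ext Q := preim_partition (h Q) setT.
have extK Q : partition Q R -> trace (ext Q) = Q.
  move=> partQ; rewrite -[RHS](preim_partition_pblock partQ).
  apply: eq_equivalence_partition => x y.
  rewrite !RE => /andP[/negPf xS /rid rx] /andP[/negPf yS /rid ry].
  by rewrite eq_pblock_preim ?in_setT // /h xS yS rx ry.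
have sub Q x y : partition Q R -> y \in pblock Q x -> y \in R.
  move=> /and3P[/eqP <- _ _]; rewrite /pblock.
  by case: pickP => [B /andP[BQ _] yB|_]; [apply/bigcupP; exists B | rewrite inE].
have hS Q x y : partition Q R -> x \in S -> (h Q x == h Q y) = (x == y).
  move=> partQ xS; apply/eqP/eqP=> [|-> //]; rewrite /h xS; case: ifP => yS e.
    by apply/eqP; rewrite -in_set1 -e set11.
  have /(sub _ _ _ partQ) : x \in pblock Q (r y) by rewrite -e set11.
  by rewrite RE xS.
have extC Q : partition Q R -> ext Q \in constrained_partitions s S A.
  move=> partQ; rewrite inE preim_partitionP /=.
  have /and3P[/eqP cov triv _] := preim_partitionP (h Q) setT.
  apply/andP; split; apply/forallP=> x; apply/implyP=> xX.
    apply/eqP/setP=> y; rewrite -eq_pblock ?cov ?inE //.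
    by rewrite eq_pblock_preim ?inE // hS // eq_sym.
  have /andP[/negPf xS /negPf sxS] := compat x xX.
  by rewrite eq_pblock_preim ?inE // /h xS sxS rs.
have traceK P : P \in constrained_partitions s S A -> ext (trace P) = P.
  rewrite inE => /and3P[partP /forall_inP PS /forall_inP PA].
  rewrite -[RHS](preim_partition_pblock partP).
  have partQ : partition (trace P) R by apply: preim_partitionP.
  have /and3P[/eqP covP trivP _] := partP.
  have PSE x y : x \in S -> (pblock P x == pblock P y) = (x == y).
    by move=> xS; rewrite eq_pblock ?covP ?inE // (eqP (PS x xS)) inE eq_sym.
  have Pr x : pblock P (r x) = pblock P x.
    apply/eqP; apply: (rind (fun y => pblock P y == pblock P x)) => // y yA.
    by rewrite (eqP (PA y yA)).
  apply: eq_equivalence_partition => x y _ _.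
  have [xS|xS] := boolP (x \in S); first by rewrite hS // PSE.
  have [yS|yS] := boolP (y \in S).
    by rewrite eq_sym hS // [RHS]eq_sym PSE.
  rewrite /h (negPf xS) (negPf yS).
  (* When [A] is [setT], [r] does not land in [R], but it is constant, so [Pr] makes [P] a single
     block. *)
  have [AT|AT] := eqVneq A setT.
    by rewrite -(Pr x) -(Pr y) !rT // !eqxx.
  by rewrite eq_pblock_preim ?rR // !Pr.
rewrite -[RHS](card_in_imset (f := ext)) => [|P Q]; last first.
  by rewrite !inE => /extK {2}<- /extK {2}<- ->.
apply: eq_card => P; apply/idP/imsetP=> [PC|[Q]]; last first.
  by rewrite inE => partQ ->; apply: extC.
by exists (trace P); rewrite ?traceK // inE preim_partitionP.
Qed.

(* Replacing [A] by its set of arc heads reverses the cycle, so that the free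
   elements ~: (S :|: s @: A) are the same for both sides. *)
Lemma card_constrained_partitionsC (T : finType) (s : T -> T) (S A : {set T}) :
    injective s -> (forall x y, fconnect s x y) -> 1 < #|T| ->
  #|constrained_partitions s (s @: A) S| = #|constrained_partitions s S A|.
Proof.
move=> sI sT T1.
have sneq x : s x != x.
  apply/eqP=> sx.
  suff : #|T| <= 1 by rewrite leqNgt T1.
  apply/card_le1P => y _ z; rewrite !inE; apply/esym/eqP.
  have cx u : u = x by rewrite -(iter_findex (sT x u)) iter_fix.
  by rewrite (cx y) (cx z).
(* An arc touching a forced singleton would put the distinct points [x] and [s x] in it. *)
have empty (U B : {set T}) x : x \in B -> (x \in U) || (s x \in U) ->
    #|constrained_partitions s U B| = 0.
  move=> xB xU; apply: eq_card0 => P; rewrite inE; apply/negP.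
  case/and3P=> [partP /forall_inP PU /forall_inP PB].
  have /and3P[/eqP covP trivP _] := partP.
  have mem y : y \in pblock P y by rewrite mem_pblock covP.
  case/orP: xU => /PU/eqP e; have := PB x xB.
    by move/eqP=> e'; have := mem (s x); rewrite e' e inE (negPf (sneq x)).
  by move/eqP=> e'; have := mem x; rewrite -e' e inE eq_sym (negPf (sneq x)).
have [/forall_inP compat|] :=
  boolP [forall x in A, (x \notin S) && (s x \notin S)]; last first.
  (* Incompatibility survives the exchange: if [x] is in [S], the arc from [x] ends in [s @: A]; if
     [s x] is in [S], the arc from [s x] starts there. *)
  rewrite negb_forall => /existsP[x]; rewrite negb_imply negb_and !negbK.
  case/andP=> xA xS; rewrite (empty _ _ _ xA xS).
  case/orP: xS => xS; first by apply: empty xS _; rewrite imset_f ?orbT.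
  by apply: empty xS _; rewrite imset_f.
rewrite card_constrained_partitions //; last first.
  move=> x xS; rewrite mem_imset //; apply/andP; split.
    by apply/imsetP=> -[y /compat/andP[_ /negPf ys] e]; rewrite -e xS in ys.
  by apply/negP=> /compat; rewrite xS.
have -> : constrained_partitions s S A =
          constrained_partitions (finv s) S (s @: A).
  apply/setP=> P; rewrite !inE; do 2!congr (_ && _).
  apply/forall_inP/forall_inP=> [PA _ /imsetP[x xA ->]|PA x xA].
    by rewrite finv_f // eq_sym PA.
  by have := PA _ (imset_f s xA); rewrite finv_f // eq_sym.
rewrite card_constrained_partitions 1?setUC // => [x y|_ /imsetP[x /compat xA ->]].
  by rewrite same_fconnect_finv.
by rewrite finv_f // andbC.
Qed.

(** * From superset counts to a bijection *)

(* Downward induction on inclusion inverts the sums over supersets. *)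
Lemma fiber_card_invariant (T X : finType) (f : X -> {set T} * {set T})
    (rho : {set T} * {set T} -> {set T} * {set T}) :
    let le (u v : {set T} * {set T}) := (u.1 \subset v.1) && (u.2 \subset v.2) in
    injective rho -> (forall u v, le (rho u) (rho v) = le u v) ->
    (forall u, #|[set x | le (rho u) (f x)]| = #|[set x | le u (f x)]|) ->
  forall u, #|[set x | f x == rho u]| = #|[set x | f x == u]|.
Proof.
move=> le rhoI rho_le cardN u.
pose w (v : {set T} * {set T}) := #|~: v.1| + #|~: v.2|.
have [m] := ubnP (w u); elim: m => // m IH in u * => wu.
have split v : #|[set x | le v (f x)]| =
    #|[set x | f x == v]| +
    \sum_(t | le v t && (t != v)) #|[set x | f x == t]|.
  rewrite -sum1_card (partition_big f (le v)) /= => [|x]; last by rewrite inE.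
  rewrite (bigD1 v) /=; last by rewrite /le !subxx.
  congr (_ + _); last apply: eq_bigr => t /andP[vt _]; rewrite -sum1_card;
    apply: eq_bigl => x; rewrite !inE; case: eqP => [->|]; rewrite ?andbF //.
    by rewrite /le !subxx.
  by rewrite vt.
(* Reindexing by [rho] matches the pairs strictly above [rho u] with those strictly above [u];
   induction equates their fibers, and cancellation leaves the two exact counts. *)
have := cardN u; rewrite !split (reindex_inj rhoI) /=.
rewrite (eq_bigl (fun t => le u t && (t != u))) => [|t]; last first.
  by rewrite rho_le (inj_eq rhoI).
rewrite (eq_bigr (fun t => #|[set x | f x == t]|)) => [/addIn //|].
move=> t /andP[/andP[s1 s2] neq]; apply: IH; apply: (@leq_trans (w u)) => //.
rewrite /w.
have [e1|n1] := eqVneq u.1 t.1.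
  rewrite e1 ltn_add2l; apply: proper_card; rewrite properC properEneq s2 andbT.
  by apply: contra neq => /eqP e2; rewrite [t]surjective_pairing -e1 -e2 -surjective_pairing.
rewrite -addSn leq_add //.
  by apply: proper_card; rewrite properC properEneq n1.
by apply: subset_leq_card; rewrite setCS.
Qed.

(** Fibers of equal size are matched by rank in their enumerations; by [idx] the default of [nth] is
    never reached. *)
Lemma bijective_of_fiber_card (X : finType) (Y : eqType) (f : X -> Y) (rho : Y -> Y) :
    injective rho ->
    (forall y, #|[set x | f x == rho y]| = #|[set x | f x == y]|) ->
  exists2 phi : X -> X, bijective phi & forall x, f (phi x) = rho (f x).
Proof.
move=> rhoI card_f.
pose F y := enum [set x | f x == y].
pose phi x := nth x (F (rho (f x))) (index x (F (f x))).
have idx x : index x (F (f x)) < size (F (rho (f x))).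
  by rewrite -cardE card_f cardE index_mem mem_enum inE.
have fphi x : f (phi x) = rho (f x).
  by have := mem_nth x (idx x); rewrite mem_enum inE => /eqP.
exists phi => //; apply: injF_bij => x y e.
have fxy : f x = f y by apply: rhoI; rewrite -!fphi e.
have := idx x; have := idx y; move: e; rewrite /phi fxy => e iy ix.
move: e; rewrite (set_nth_default y) // => /eqP.
rewrite nth_uniq ?enum_uniq // => /eqP e.
have xF : x \in F (f y) by rewrite mem_enum inE fxy.
have yF : y \in F (f y) by rewrite mem_enum inE.
by rewrite -(nth_index x xF) e nth_index.
Qed.

(** * The cycle on ['I_n] and its two statistics *)

Lemma fconnect_ordS (n : nat) (x y : 'I_n) : fconnect (@ordS n) x y.
Proof.
have it k : k <= n -> iter k (@ordS n) x = (x + k) %% n :> nat.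
  elim: k => [_|k IH kn]; first by rewrite addn0 modn_small.
  by rewrite /= IH 1?ltnW // -addn1 modnDml addn1 addnS.
(* The number of steps is [y - x] modulo [n], written with [n - x] so that no subtraction
   truncates. *)
have -> : y = iter ((y + (n - x)) %% n) (@ordS n) x.
  apply: val_inj => /=; have xn := ltn_ord x.
  rewrite it; last by rewrite ltnW // ltn_pmod // (leq_trans _ xn).
  by rewrite modnDmr addnCA subnKC 1?ltnW // modnDr modn_small.
exact: fconnect_iter.
Qed.

(** Recording singletons by their points and adjacencies by their tails makes both statistics
    subsets of ['I_n], which can then be exchanged. *)
Definition singleton_points (n : nat) (P : {set {set 'I_n}}) : {set 'I_n} :=
  [set i | pblock P i == [set i]].

Definition adjacency_tails (n : nat) (P : {set {set 'I_n}}) : {set 'I_n} :=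
  [set i | pblock P (ordS i) == pblock P i].

Lemma card_singletons (n : nat) (P : set_partition n) :
  #|singletons P| = #|singleton_points (val P)|.
Proof.
have /and3P[/eqP cov triv _] := valP P.
rewrite -[RHS](card_imset _ set1_inj); apply: eq_card => B; rewrite inE.
apply/andP/imsetP=> [[BP /cards1P[i Bi]]|[i]].
  by exists i => //; rewrite inE -Bi (def_pblock triv BP) // Bi set11.
rewrite inE => /eqP e ->; rewrite cards1; split=> //.
by rewrite -e pblock_mem // cov.
Qed.

Lemma card_adjacencies (n : nat) (P : set_partition n) :
  #|adjacencies P| = #|adjacency_tails (val P)|.
Proof.
have /and3P[/eqP cov triv _] := valP P.
rewrite -[RHS](card_imset (f := fun i => (i, ordS i))) => [|i j [] //].
apply: eq_card => -[i j]; rewrite inE /=.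
apply/andP/imsetP=> [[/eqP -> /exists_inP[B BP /andP[iB jB]]]|[k]].
  by exists i => //; rewrite inE !(def_pblock triv BP).
rewrite inE => /eqP e [-> ->]; split=> //; apply/exists_inP.
exists (pblock (val P) k); first by rewrite pblock_mem // cov.
by rewrite mem_pblock cov inE /= -e mem_pblock cov.
Qed.

Lemma card_set_partition (n : nat) (S A : {set 'I_n}) :
  #|[set P : {P : {set {set 'I_n}} | partition P [set: 'I_n]} |
     (S \subset singleton_points (val P)) && (A \subset adjacency_tails (val P))]| =
  #|constrained_partitions (@ordS n) S A|.
Proof.
rewrite -(card_imset _ val_inj); apply: eq_card => P.
have subE Q : [forall x in S, pblock Q x == [set x]] &&
    [forall x in A, pblock Q (ordS x) == pblock Q x] =
    (S \subset singleton_points Q) && (A \subset adjacency_tails Q).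
  by congr (_ && _); apply/forall_inP/subsetP=> H x /H; rewrite inE.
rewrite inE subE; apply/imsetP/andP=> [[Q] | [partP PSA]].
  by rewrite inE => QSA ->; split=> //; exact: (valP Q).
by exists (Sub P partP) => //; rewrite inE SubK.
Qed.

Theorem theorem1 (n : nat) (hn : 0 < n) :
  exists phi : set_partition n -> set_partition n,
    bijective phi /\
    forall P : set_partition n,
      #|singletons (phi P)| = #|adjacencies P| /\
      #|adjacencies (phi P)| = #|singletons P|.
Proof.
(* For [n = 1] the unique point gives one singleton and one adjacency, so the identity works. *)
have [n1|n1] := leqP n 1.
  have {n1 hn} -> : n = 1 by apply/eqP; rewrite eqn_leq n1.
  exists id; split=> [|P]; first by exists id.
  suff e : #|singletons P| = #|adjacencies P| by rewrite e.
  rewrite card_singletons card_adjacencies; apply: eq_card => i; rewrite !inE.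
  have /and3P[/eqP cov _ _] := valP P.
  rewrite [ordS i]ord1 [i]ord1 eqxx; apply/eqP/setP=> j.
  by rewrite [j]ord1 mem_pblock cov !inE.
pose X := {P : {set {set 'I_n}} | partition P [set: 'I_n]}.
pose f (P : X) := (singleton_points (val P), adjacency_tails (val P)).
(* The half-step rotation: a point [i] becomes the arc with tail [i], and an arc becomes its head.
   Applied twice, it rotates the cycle by one step. *)
pose rho (u : {set 'I_n} * {set 'I_n}) := (@ordS n @: u.2, u.1).
have sI : injective (@ordS n) := bij_inj (@ordS_bij n).
have rhoI : injective rho by move=> [a b] [c d] [/(imset_inj sI) -> ->].
have [||phi phi_bij fphi] := @bijective_of_fiber_card X _ f rho.
- exact: rhoI.
- apply: fiber_card_invariant => // [u v|u] /=.
    rewrite andbC; congr (_ && _); apply/subsetP/subsetP=> H x.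
      by move=> xu; have := H _ (imset_f (@ordS n) xu); rewrite mem_imset.
    by case/imsetP=> y /H yv ->; apply: imset_f.
  rewrite !card_set_partition card_constrained_partitionsC ?card_ord //.
  exact: fconnect_ordS.
exists phi; split=> // P; have [eS eA] := fphi P.
by rewrite !card_singletons !card_adjacencies eS eA card_imset.
Qed.
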